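(* Let $p$ be a prime, $K$ a field of characteristic $p$, $n\geq2$ an integer, $r=n-1$, and $f\in K^\times$. Let $A=K[t]/(t^{p^n})$ with the Hopf algebra structure given by $\Delta(t)=t\otimes1+1\otimes t+f\sum_{\ell=1}^{p-1}\frac{1}{\ell!(p-\ell)!}t^{p^{r}\ell}\otimes t^{p^{r}(p-\ell)}$, $\varepsilon(t)=0$, $\lambda(t)=-t$, let $H=\operatorname{Hom}_K(A,K)$ be its dual Hopf algebra, and for $0\le j\le p^n-1$ let $z_j\in H$ be defined by $z_j(t^i)=\delta_{i,j}$; thus $H=K[z_{p},\dots,z_{p^{r}}]/(z_{p}^{p},\dots,z_{p^{r-1}}^{p},z_{p^{r}}^{p^{2}})$ with $\Delta(z_{p^s})=\sum_{i=0}^{p^s}z_{p^s-i}\otimes z_i$. Let $L=K(x)$ be a field extension of degree $p^n$ with $x^{p^n}\in K$, and let $\alpha:L\to L\otimes_K A$ be the $K$-algebra homomorphism with \[ \alpha(x)=x\otimes1+1\otimes t+f\sum_{\ell=1}^{p-1}\frac{1}{\ell!(p-\ell)!}x^{p^{r}\ell}\otimes t^{p^{r}(p-\ell)}, \] and let $H$ act on $L$ by $h(y)=\operatorname{mult}(1\otimes h)\alpha(y)$. For $0\leq i\leq p^{n}-1$ write $i=\sum_{\ell=0}^{r}i_{(\ell)}p^{\ell}$ with $0\le i_{(\ell)}\le p-1$. Then for $0\leq s\leq r-1$, \[ z_{p^{s}}(x^{i})=i_{(s)}x^{i-p^{s}}, \] and \[ z_{p^{r}}(x^{i})=i_{(r)}x^{i-p^{r}}-i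 f x^{p^{r}(p-1)+i-1}. \]
   Context: $\delta_{i,j}$ is the Kronecker delta. The coefficients $1/(\ell!(p-\ell)!)$ are interpreted in $\mathbb{F}_p\subseteq K$, and integers such as $i_{(s)}$ and $i$ are read in $\mathbb{F}_p\subseteq K$. Negative powers of $x$ are taken in the field $L$. The dual $H$ has multiplication $(\phi\psi)(h)=\operatorname{mult}(\phi\otimes\psi)\Delta(h)$ and comultiplication determined by $\Delta(\phi)(a\otimes b)=\phi(ab)$. *)

(* Defs.v *)
From HB Require Import structures.
From mathcomp Require Import all_boot all_order all_algebra all_field.
From mathcomp Require Export qpoly.
From mathcomp Require Export mpoly.

Set Implicit Arguments.
Unset Strict Implicit.
Unset Printing Implicit Defensive.

Import GRing.Theory.
Local Open Scope ring_scope.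

Reserved Notation "a \ox b" (at level 35, no associativity).

(* The tensor product of two finite-dimensional vector spaces, in coordinates
   with respect to the library's bases vbasis {:U} and vbasis {:V}.  The lemmas
   tlift_tens and tens_ind show that it has the universal property. *)
Definition tensor (K : fieldType) (U V : vectType K) : Type :=
  'M[K]_(\dim {:U}, \dim {:V}).

Section TensorVect.
Variables (K : fieldType) (U V : vectType K).

HB.instance Definition _ :=
  Vector.copy (tensor U V) 'M[K]_(\dim {:U}, \dim {:V}).

Definition tens (u : U) (v : V) : tensor U V :=
  \matrix_(i, j) (coord (vbasis {:U}) i u * coord (vbasis {:V}) j v).

Definition bilin (W : lmodType K) (b : U -> V -> W) : Prop :=
  (forall v, linear (b^~ v)) /\ (forall u, linear (b u)).

Definition tlift (W : lmodType K) (b : U -> V -> W) (T : tensor U V) : W :=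
  \sum_i \sum_j T i j *: b (vbasis {:U})`_i (vbasis {:V})`_j.

Lemma tlift_is_linear (W : lmodType K) (b : U -> V -> W) : linear (tlift b).
Proof.
move=> c S T; rewrite /tlift scaler_sumr -big_split /=; apply: eq_bigr => i _.
rewrite scaler_sumr -big_split /=; apply: eq_bigr => j _.
by rewrite !mxE scalerDl scalerA.
Qed.

HB.instance Definition _ (W : lmodType K) (b : U -> V -> W) :=
  GRing.isSemilinear.Build K (tensor U V) W _ (tlift b)
    (GRing.semilinear_linear (tlift_is_linear b)).

Lemma tens_bilin : bilin tens.
Proof.
split=> [v a u u'|u a v v']; apply/matrixP => i j; rewrite !mxE linearP /=.
  by rewrite mulrDl mulrA.
by rewrite mulrDr mulrCA.
Qed.

Lemma tensPl a u u' v : tens (a *: u + u') v = a *: tens u v + tens u' v.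
Proof. exact: (tens_bilin.1 v a u u'). Qed.
Lemma tensPr a u v v' : tens u (a *: v + v') = a *: tens u v + tens u v'.
Proof. exact: (tens_bilin.2 u a v v'). Qed.

Lemma tensDl u u' v : tens (u + u') v = tens u v + tens u' v.
Proof. by rewrite -[u]scale1r tensPl !scale1r. Qed.
Lemma tensDr u v v' : tens u (v + v') = tens u v + tens u v'.
Proof. by rewrite -[v]scale1r tensPr !scale1r. Qed.
Lemma tens0l v : tens 0 v = 0.
Proof. by apply: (addIr (tens 0 v)); rewrite -tensDl !add0r. Qed.
Lemma tens0r u : tens u 0 = 0.
Proof. by apply: (addIr (tens u 0)); rewrite -tensDr !add0r. Qed.
Lemma tensZl a u v : tens (a *: u) v = a *: tens u v.
Proof. by rewrite -[a *: u]addr0 tensPl tens0l addr0. Qed.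
Lemma tensZr a u v : tens u (a *: v) = a *: tens u v.
Proof. by rewrite -[a *: v]addr0 tensPr tens0r addr0. Qed.

Lemma tens_suml (I : finType) (F : I -> U) v :
  tens (\sum_i F i) v = \sum_i tens (F i) v.
Proof. by apply: (big_morph (tens^~ v)) => [u u'|]; rewrite (tensDl, tens0l). Qed.
Lemma tens_sumr (I : finType) u (F : I -> V) :
  tens u (\sum_i F i) = \sum_i tens u (F i).
Proof. by apply: (big_morph (tens u)) => [v v'|]; rewrite (tensDr, tens0r). Qed.

Lemma tens_vbasis (i : 'I_(\dim {:U})) (j : 'I_(\dim {:V})) :
  tens (vbasis {:U})`_i (vbasis {:V})`_j = delta_mx i j :> 'M_(_, _).
Proof.
apply/matrixP => k l; rewrite !mxE !coord_free ?(basis_free (vbasisP _)) //.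
by rewrite -natrM mulnb ![_ == i]eq_sym ![_ == j]eq_sym.
Qed.

Lemma tensorE (T : tensor U V) :
  T = \sum_i \sum_j T i j *: tens (vbasis {:U})`_i (vbasis {:V})`_j.
Proof.
rewrite {1}[T]matrix_sum_delta; apply: eq_bigr => i _; apply: eq_bigr => j _.
by rewrite tens_vbasis.
Qed.

Lemma tens_ind (P : tensor U V -> Prop) :
  (forall u v, P (tens u v)) -> (forall S T, P S -> P T -> P (S + T)) ->
  forall T, P T.
Proof.
move=> Ptens PD T; have P0 : P 0 by rewrite -(tens0l 0).
rewrite [T]tensorE; apply: (big_ind P) => // i _; apply: (big_ind P) => // j _.
by rewrite -tensZl.
Qed.

Lemma tlift_tens (W : lmodType K) (b : U -> V -> W) u v :
  bilin b -> tlift b (tens u v) = b u v.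
Proof.
move=> [bl br].
pose bL v' : {linear U -> W} := HB.pack (b^~ v') (GRing.isSemilinear.Build
  K U W _ (b^~ v') (GRing.semilinear_linear (bl v'))).
pose bR u' : {linear V -> W} := HB.pack (b u') (GRing.isSemilinear.Build
  K V W _ (b u') (GRing.semilinear_linear (br u'))).
have bZl k x y : b (k *: x) y = k *: b x y by exact: (linearZ_LR (bL y)).
have bZr k x y : b x (k *: y) = k *: b x y by exact: (linearZ_LR (bR x)).
have bsl n (F : 'I_n -> U) y : b (\sum_i F i) y = \sum_i b (F i) y.
  exact: (linear_sum (bL y)).
have bsr n (F : 'I_n -> V) x : b x (\sum_i F i) = \sum_i b x (F i).
  exact: (linear_sum (bR x)).
rewrite [u in RHS](coord_vbasis (memvf u)) [v in RHS](coord_vbasis (memvf v)).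
rewrite bsl; apply: eq_bigr => i _; rewrite bZl bsr scaler_sumr.
by apply: eq_bigr => j _; rewrite bZr scalerA mxE.
Qed.

Lemma tens_neq0 u v : u != 0 -> v != 0 -> tens u v != 0.
Proof.
move=> u0 v0; apply/eqP => /matrixP uv0.
have [i ui] : exists i, coord (vbasis {:U}) i u != 0.
  apply/existsP; apply: contraR u0; rewrite negb_exists => /forallP u0.
  rewrite (coord_vbasis (memvf u)) big1 // => i _.
  by have /eqP -> := negbNE (u0 i); rewrite scale0r.
have [j vj] : exists j, coord (vbasis {:V}) j v != 0.
  apply/existsP; apply: contraR v0; rewrite negb_exists => /forallP v0.
  rewrite (coord_vbasis (memvf v)) big1 // => j _.
  by have /eqP -> := negbNE (v0 j); rewrite scale0r.
by have /eqP := uv0 i j; rewrite !mxE mulf_eq0 (negPf ui) (negPf vj).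
Qed.

End TensorVect.

Notation "a \ox b" := (tens a b) : ring_scope.

Section TensorMaps.
Variables (K : fieldType) (U V U' V' W : vectType K).

Definition tmap (f : U -> U') (g : V -> V') : tensor U V -> tensor U' V' :=
  tlift (fun u v => f u \ox g v).

HB.instance Definition _ (f : U -> U') (g : V -> V') :=
  GRing.Linear.copy (tmap f g) (tlift (fun u v => f u \ox g v)).

Lemma tmapE (f : {linear U -> U'}) (g : {linear V -> V'}) u v :
  tmap f g (u \ox v) = f u \ox g v.
Proof.
rewrite [LHS]tlift_tens //; split=> ? a b c; rewrite linearP.
  exact: tensPl.
exact: tensPr.
Qed.

Definition tassoc : tensor (tensor U V) W -> tensor U (tensor V W) :=
  tlift (fun T w => tlift (fun u v => u \ox (v \ox w)) T).

HB.instance Definition _ := GRing.Linear.copy tassoc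
  (tlift (fun T w => tlift (fun u v => u \ox (v \ox w)) T)).

Lemma tassocE u v w : tassoc ((u \ox v) \ox w) = u \ox (v \ox w).
Proof.
have bil x : bilin (fun u v => u \ox (v \ox x) : tensor U (tensor V W)).
  by split=> ? a b c; rewrite ?tensPl ?tensPr.
rewrite [LHS]tlift_tens ?tlift_tens //; split=> [x|T] a b c.
  exact: linearP.
elim/tens_ind: T => [x y|S T IHS IHT]; first by rewrite !tlift_tens ?tensPr.
rewrite !(linearD (tlift _)) /= IHS IHT scalerDr; exact: addrACA.
Qed.

(* The multiplication U (x) K -> U *)
Definition tscale : tensor U K^o -> U := tlift (fun (u : U) (c : K^o) => (c : K) *: u).

HB.instance Definition _ := GRing.Linear.copy tscale
  (tlift (fun (u : U) (c : K^o) => (c : K) *: u)).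

Lemma tscaleE (u : U) (c : K^o) : tscale (u \ox c) = (c : K) *: u.
Proof.
rewrite [LHS]tlift_tens //; split=> ? a b d; last by rewrite scalerDl -scalerA.
by rewrite scalerDr !scalerA mulrC.
Qed.

End TensorMaps.

Section TensorAlg.
Variables (K : fieldType) (A B : falgType K).

Definition tmul (S T : tensor A B) : tensor A B :=
  tlift (fun a b => tlift (fun c d => (a * c) \ox (b * d)) T) S.

Lemma tmul_bil a b : bilin (fun c d => (a * c) \ox (b * d) : tensor A B).
Proof. by split=> ? k ? ?; rewrite mulrDr -scalerAr (tensPl, tensPr). Qed.

Lemma tmulPl k S S' T : tmul (k *: S + S') T = k *: tmul S T + tmul S' T.
Proof. exact: linearP. Qed.

Lemma tmulDl S S' T : tmul (S + S') T = tmul S T + tmul S' T.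
Proof. exact: linearD. Qed.

Let bil' T :
  bilin (fun a b => tlift (fun c d => (a * c) \ox (b * d) : tensor A B) T).
Proof.
split=> ? k ? ?; elim/tens_ind: T => [x y|S T IHS IHT].
- by rewrite !tlift_tens ?mulrDl -?scalerAl ?tensPl //; apply: tmul_bil.
- rewrite !(linearD (tlift _)) /= IHS IHT scalerDr; exact: addrACA.
- by rewrite !tlift_tens ?mulrDl -?scalerAl ?tensPr //; apply: tmul_bil.
- rewrite !(linearD (tlift _)) /= IHS IHT scalerDr; exact: addrACA.
Qed.

Lemma tmulE a b c d : tmul (a \ox b) (c \ox d) = (a * c) \ox (b * d).
Proof. by rewrite /tmul tlift_tens // tlift_tens //; apply: tmul_bil. Qed.

Lemma tmulDr S T T' : tmul S (T + T') = tmul S T + tmul S T'.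
Proof.
elim/tens_ind: S => [a b|S S' IH IH']; last by rewrite !tmulDl IH IH' addrACA.
by rewrite /tmul !tlift_tens //; exact: linearD.
Qed.

Lemma tmulZl k S T : k *: tmul S T = tmul (k *: S) T.
Proof. by rewrite /tmul linearZ. Qed.

Lemma tmulZr k S T : k *: tmul S T = tmul S (k *: T).
Proof.
elim/tens_ind: S => [a b|S S' IH IH']; last by rewrite !tmulDl scalerDr IH IH'.
by rewrite /tmul !tlift_tens // linearZ.
Qed.

Lemma tmulA : associative tmul.
Proof.
move=> S T R; elim/tens_ind: S => [a b|S S' h h']; last by rewrite !tmulDl h h'.
elim/tens_ind: T => [c d|T T' h h']; last by rewrite !(tmulDl, tmulDr) h h'.
elim/tens_ind: R => [e g|R R' h h']; last by rewrite !tmulDr h h'.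
by rewrite !tmulE !mulrA.
Qed.

Lemma tmul1l : left_id (1 \ox 1) tmul.
Proof.
elim/tens_ind => [a b|S T h h']; last by rewrite tmulDr h h'.
by rewrite tmulE !mul1r.
Qed.

Lemma tmul1r : right_id (1 \ox 1) tmul.
Proof.
elim/tens_ind => [a b|S T h h']; last by rewrite tmulDl h h'.
by rewrite tmulE !mulr1.
Qed.

Lemma tens1_neq0 : (1 : A) \ox (1 : B) != 0.
Proof. by rewrite tens_neq0 ?oner_neq0. Qed.

HB.instance Definition _ := GRing.Zmodule_isNzRing.Build (tensor A B)
  tmulA tmul1l tmul1r tmulDl (fun S T T' => tmulDr S T T') tens1_neq0.
HB.instance Definition _ := GRing.Lmodule_isLalgebra.Build K (tensor A B) tmulZl.
HB.instance Definition _ := GRing.Lalgebra_isAlgebra.Build K (tensor A B) tmulZr.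
HB.instance Definition _ := Algebra_isFalgebra.Build K (tensor A B).

Lemma tensM (a c : A) (b d : B) : (a \ox b) * (c \ox d) = (a * c) \ox (b * d).
Proof. exact: tmulE. Qed.

Lemma tens1 : (1 : A) \ox (1 : B) = 1.
Proof. by []. Qed.

End TensorAlg.

Section Mult.
Variables (K : fieldType) (A : falgType K).

Definition tmult : tensor A A -> A := tlift *%R.
HB.instance Definition _ := GRing.Linear.copy tmult (tlift *%R).

Lemma tmultE a b : tmult (a \ox b) = a * b.
Proof.
rewrite [LHS]tlift_tens //; split=> ? k ? ?; first by rewrite mulrDl -scalerAl.
by rewrite mulrDr -scalerAr.
Qed.

End Mult.

HB.instance Definition _ (K : fieldType) (h : {poly K}) :=
  GRing.UnitAlgebra.on {poly_(size (mk_monic h)).-1 K}.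

Record hopf (K : fieldType) (A : falgType K) : Type := Hopf {
  comul : {lrmorphism A -> tensor A A};
  counit : {lrmorphism A -> K^o};
  antipode : {linear A -> A};
  coassoc : forall a,
    tassoc (tmap comul idfun (comul a)) = tmap idfun comul (comul a);
  counitl : forall a, tmap counit idfun (comul a) = 1 \ox a;
  counitr : forall a, tmap idfun counit (comul a) = a \ox 1;
  antipodel : forall a, tmult (tmap antipode idfun (comul a)) = (counit a)%:A;
  antipoder : forall a, tmult (tmap idfun antipode (comul a)) = (counit a)%:A
}.

(* The linear dual Hom_K(A, K), with the convolution product *)
Definition dual (K : fieldType) (A : falgType K) (HA : hopf A) : Type :=
  'Hom(A, K^o).

Section DualAlg.
Variables (K : fieldType) (A : falgType K) (HA : hopf A).
Local Notation H := (dual HA).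

HB.instance Definition _ := Vector.copy H 'Hom(A, K^o).

Implicit Types (phi psi : H).

Definition conv phi psi : H :=
  linfun (fun a => tmult (tmap phi psi (comul HA a))).
Definition conv1 : H := linfun (counit HA).

Lemma dualP phi psi : (forall a, phi a = psi a) <-> phi = psi.
Proof. by split=> [/lfunP|->]. Qed.

Lemma dualDE phi psi a : (phi + psi) a = phi a + psi a.
Proof. exact: add_lfunE. Qed.
Lemma dualZE k phi a : (k *: phi) a = k *: phi a.
Proof. exact: scale_lfunE. Qed.

Lemma convE phi psi a : conv phi psi a = tmult (tmap phi psi (comul HA a)).
Proof.
rewrite /conv; pose g := (@tmult _ _ \o tmap phi psi \o comul HA).
by rewrite (lfunE (GRing.Linear.clone _ _ _ _ _ g)).
Qed.

Lemma conv1E a : conv1 a = counit HA a.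
Proof. exact: lfunE. Qed.

Let pair2 phi psi : {linear tensor A A -> K^o} := @tmult _ _ \o tmap phi psi.

Let pair3 phi psi chi : {linear tensor A (tensor A A) -> K^o} :=
  @tmult _ _ \o tmap phi (pair2 psi chi).

Lemma convA : associative conv.
Proof.
move=> phi psi chi; apply/dualP => a; rewrite !convE; apply/esym.
transitivity (pair3 phi psi chi (tassoc (tmap (comul HA) idfun (comul HA a)))).
  elim/tens_ind: (comul HA a) => [u v|S T hS hT]; last by move: hS hT; rewrite !linearD /= => -> ->.
  rewrite !tmapE tmultE /= convE.
  elim/tens_ind: (comul HA u) => [x y|S T hS hT].
    by rewrite tassocE /= !tmapE /= tmapE !tmultE /= mulrA.
  by rewrite tensDl !linearD /= mulrDl hS hT.
rewrite coassoc.
elim/tens_ind: (comul HA a) => [u v|S T hS hT]; last by move: hS hT; rewrite !linearD /= => -> ->.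
by rewrite !tmapE /= tmapE /= !tmultE /= convE.
Qed.

Lemma conv1l : left_id conv1 conv.
Proof.
move=> phi; apply/dualP => a; rewrite convE.
pose g : {linear tensor K^o A -> K^o} := @tmult _ _ \o tmap idfun phi.
transitivity (g (tmap (counit HA) idfun (comul HA a))); last first.
  by rewrite counitl /= tmapE tmultE mul1r.
elim/tens_ind: (comul HA a) => [u v|S T hS hT]; last by move: hS hT; rewrite !linearD /= => -> ->.
by rewrite /= !tmapE /= conv1E.
Qed.

Lemma conv1r : right_id conv1 conv.
Proof.
move=> phi; apply/dualP => a; rewrite convE.
pose g : {linear tensor A K^o -> K^o} := @tmult _ _ \o tmap phi idfun.
transitivity (g (tmap idfun (counit HA) (comul HA a))); last first.
  by rewrite counitr /= tmapE tmultE mulr1.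
elim/tens_ind: (comul HA a) => [u v|S T hS hT]; last by move: hS hT; rewrite !linearD /= => -> ->.
by rewrite /= !tmapE /= conv1E.
Qed.

Lemma convPl k phi phi' psi :
  conv (k *: phi + phi') psi = k *: conv phi psi + conv phi' psi.
Proof.
apply/dualP => a; rewrite dualDE dualZE !convE.
elim/tens_ind: (comul HA a) => [u v|S T hS hT].
  by rewrite !tmapE !tmultE /= dualDE dualZE mulrDl scalerAl.
by move: hS hT; rewrite !linearD /= => -> ->; rewrite addrACA.
Qed.

Lemma convPr k phi psi psi' :
  conv phi (k *: psi + psi') = k *: conv phi psi + conv phi psi'.
Proof.
apply/dualP => a; rewrite dualDE dualZE !convE.
elim/tens_ind: (comul HA a) => [u v|S T hS hT].
  by rewrite !tmapE !tmultE /= dualDE dualZE mulrDr scalerAr.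
by move: hS hT; rewrite !linearD /= => -> ->; rewrite addrACA.
Qed.

Lemma convDl : left_distributive conv +%R.
Proof. by move=> phi phi' psi; rewrite -[phi]scale1r convPl !scale1r. Qed.
Lemma convDr : right_distributive conv +%R.
Proof. by move=> phi psi psi'; rewrite -[psi]scale1r convPr !scale1r. Qed.

Lemma conv0l psi : conv 0 psi = 0.
Proof. by apply: (addIr (conv 0 psi)); rewrite -convDl !add0r. Qed.
Lemma conv0r phi : conv phi 0 = 0.
Proof. by apply: (addIr (conv phi 0)); rewrite -convDr !add0r. Qed.

Lemma convZl k phi psi : k *: conv phi psi = conv (k *: phi) psi.
Proof. by rewrite -[k *: phi]addr0 convPl conv0l addr0. Qed.
Lemma convZr k phi psi : k *: conv phi psi = conv phi (k *: psi).
Proof. by rewrite -[k *: psi]addr0 convPr conv0r addr0. Qed.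

Lemma conv1_neq0 : conv1 != 0.
Proof.
apply/eqP => /dualP/(_ 1)/eqP; rewrite conv1E rmorph1 zero_lfunE.
by rewrite oner_eq0.
Qed.

HB.instance Definition _ := GRing.Zmodule_isNzRing.Build H
  convA conv1l conv1r convDl convDr conv1_neq0.
HB.instance Definition _ := GRing.Lmodule_isLalgebra.Build K H convZl.
HB.instance Definition _ := GRing.Lalgebra_isAlgebra.Build K H convZr.
HB.instance Definition _ := Algebra_isFalgebra.Build K H.

Lemma dualME phi psi a : (phi * psi) a = tmult (tmap phi psi (comul HA a)).
Proof. exact: convE. Qed.

Lemma dual1E a : (1 : H) a = counit HA a.
Proof. exact: conv1E. Qed.

End DualAlg.

Section DualHopf.
Variables (K : fieldType) (A : falgType K) (HA : hopf A).
Local Notation H := (dual HA).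

Implicit Types (phi psi : H).

Section Contr.
Variable V : vectType K.

Definition contr (a : A) : tensor H V -> V :=
  tlift (fun (phi : H) v => (phi a : K) *: v).
HB.instance Definition _ a := GRing.Linear.copy (contr a)
  (tlift (fun (phi : H) (v : V) => (phi a : K) *: v)).

Lemma contrE a phi v : contr a (phi \ox v) = (phi a : K) *: v.
Proof.
rewrite [LHS]tlift_tens //; split=> ? k ? ?; last by rewrite linearP.
by rewrite dualDE dualZE scalerDl -scalerA.
Qed.

Definition dcoord (i : 'I_(\dim {:A})) : H :=
  linfun (coord (vbasis {:A}) i : A -> K^o).

Lemma dcoordE i a : dcoord i a = coord (vbasis {:A}) i a.
Proof. exact: (lfunE (coord (vbasis {:A}) i : {linear A -> K^o})). Qed.

Lemma dual_sum_coord phi :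
  phi = \sum_(i < \dim {:A}) (phi (vbasis {:A})`_i : K) *: dcoord i.
Proof.
apply/dualP => a; rewrite [a in LHS](coord_vbasis (memvf a)) linear_sum /=.
rewrite sum_lfunE; apply: eq_bigr => i _.
by rewrite linearZ scale_lfunE dcoordE /= [RHS]mulrC.
Qed.

Lemma contr_sum T : T = \sum_(i < \dim {:A}) dcoord i \ox contr (vbasis {:A})`_i T.
Proof.
elim/tens_ind: T => [phi v|S T hS hT].
  rewrite {1}[phi]dual_sum_coord tens_suml; apply: eq_bigr => i _.
  by rewrite contrE tensZl tensZr.
rewrite {1}hS {1}hT -big_split; apply: eq_bigr => i _.
by rewrite linearD tensDr.
Qed.

Lemma contr_inj S T : (forall a, contr a S = contr a T) -> S = T.
Proof.
move=> ST; rewrite [S]contr_sum [T]contr_sum.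
by apply: eq_bigr => i _; rewrite ST.
Qed.

End Contr.

(* teval (phi (x) psi) a b = phi(a) psi(b) *)
Definition teval (T : tensor H H) (a b : A) : K :=
  tlift (fun phi psi : H => (phi a * psi b : K^o)) T.

Lemma teval_bil a b : bilin (fun phi psi : H => (phi a * psi b : K^o)).
Proof.
split=> ? k ? ?; rewrite dualDE dualZE; first by rewrite mulrDl scalerAl.
by rewrite mulrDr scalerAr.
Qed.

Lemma tevalE phi psi a b : teval (phi \ox psi) a b = phi a * psi b.
Proof. by rewrite /teval tlift_tens //; apply: teval_bil. Qed.

Lemma tevalD S T a b : teval (S + T) a b = teval S a b + teval T a b.
Proof.
exact: (linearD (tlift (fun phi psi : H => (phi a * psi b : K^o)))).
Qed.

Lemma tevalZ k T a b : teval (k *: T) a b = k * teval T a b.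
Proof.
exact: (linearZ_LR (tlift (fun phi psi : H => (phi a * psi b : K^o)))).
Qed.

Lemma teval_contr T a b : teval T a b = contr a T b.
Proof.
elim/tens_ind: T => [phi psi|S T hS hT]; first by rewrite tevalE contrE dualZE.
by rewrite tevalD linearD dualDE hS hT.
Qed.

Lemma teval_linl T b : linear (fun a => teval T a b : K^o).
Proof.
move=> k a a'; elim/tens_ind: T => [phi psi|S T hS hT].
  by rewrite !tevalE linearP mulrDl scalerAl.
by rewrite !tevalD hS hT scalerDr addrACA.
Qed.

Lemma teval_linr T a : linear (fun b => teval T a b : K^o).
Proof. by move=> k b b'; rewrite !teval_contr linearP. Qed.

Lemma teval_inj S T : (forall a b, teval S a b = teval T a b) -> S = T.
Proof.
move=> ST; apply: contr_inj => a; apply/dualP => b.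
by rewrite -!teval_contr.
Qed.

(* The transpose of the multiplication of A, characterized by dcomulE *)
Definition dcomul phi : tensor H H :=
  \sum_(i < \dim {:A}) \sum_(j < \dim {:A}) (phi ((vbasis {:A})`_i * (vbasis {:A})`_j) : K) *:
    (dcoord i \ox dcoord j).

Lemma dcomulE phi a b : teval (dcomul phi) a b = phi (a * b).
Proof.
have tevals n (F : 'I_n -> tensor H H) x y :
    teval (\sum_i F i) x y = \sum_i teval (F i) x y.
  exact: (linear_sum (tlift (fun phi psi : H => (phi x * psi y : K^o)))).
rewrite [a in RHS](coord_vbasis (memvf a)) [b in RHS](coord_vbasis (memvf b)).
rewrite mulr_suml linear_sum tevals; apply: eq_bigr => i _.
rewrite mulr_sumr linear_sum tevals; apply: eq_bigr => j _.
rewrite tevalZ tevalE !dcoordE -scalerAl -scalerAr !linearZ /=.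
by rewrite mulrC -mulrA.
Qed.

Lemma dcomul_is_linear : linear dcomul.
Proof.
move=> k phi psi; apply: teval_inj => a b.
by rewrite tevalD tevalZ !dcomulE dualDE dualZE.
Qed.
HB.instance Definition _ := GRing.isSemilinear.Build K H (tensor H H) _ dcomul
  (GRing.semilinear_linear dcomul_is_linear).

Section Omega.
Variables S T : tensor H H.
Let om1 u u' v v' : K^o := teval S u v * teval T u' v'.
Let om2 Y u u' : K^o := tlift (om1 u u') Y.
Definition omega X Y : K^o := tlift (om2 Y) X.

Lemma om1_bil u u' : bilin (om1 u u').
Proof.
split=> ? k ? ?; rewrite /om1 teval_linr; first by rewrite mulrDl scalerAl.
by rewrite mulrDr scalerAr.
Qed.

Lemma om2_bil Y : bilin (om2 Y).
Proof.
split=> ? k ? ?; rewrite /om2; elim/tens_ind: Y => [v v'|X Y hX hY].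
- rewrite !tlift_tens; try exact: om1_bil.
  by rewrite /om1 teval_linl mulrDl scalerAl.
- by rewrite !(linearD (tlift _)) /= hX hY scalerDr addrACA.
- rewrite !tlift_tens; try exact: om1_bil.
  by rewrite /om1 teval_linl mulrDr scalerAr.
- by rewrite !(linearD (tlift _)) /= hX hY scalerDr addrACA.
Qed.

Lemma omegaE u u' v v' :
  omega (u \ox u') (v \ox v') = teval S u v * teval T u' v'.
Proof.
by rewrite /omega (tlift_tens _ _ (om2_bil _)) /om2 (tlift_tens _ _ (om1_bil _ _)).
Qed.

Lemma omegaDl X X' Y : omega (X + X') Y = omega X Y + omega X' Y.
Proof. exact: linearD. Qed.

Lemma omegaDr X Y Y' : omega X (Y + Y') = omega X Y + omega X Y'.
Proof.
elim/tens_ind: X => [u u'|X X' hX hX']; last by rewrite !omegaDl hX hX' addrACA.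
rewrite /omega !tlift_tens; try exact: om2_bil.
exact: linearD.
Qed.
End Omega.

Lemma omegaS S S' T X Y : omega (S + S') T X Y = omega S T X Y + omega S' T X Y.
Proof.
elim/tens_ind: X => [u u'|X X' h h']; last by rewrite !omegaDl h h' addrACA.
elim/tens_ind: Y => [v v'|Y Y' h h']; last by rewrite !omegaDr h h' addrACA.
by rewrite !omegaE tevalD mulrDl.
Qed.

Lemma omegaT S T T' X Y : omega S (T + T') X Y = omega S T X Y + omega S T' X Y.
Proof.
elim/tens_ind: X => [u u'|X X' h h']; last by rewrite !omegaDl h h' addrACA.
elim/tens_ind: Y => [v v'|Y Y' h h']; last by rewrite !omegaDr h h' addrACA.
by rewrite !omegaE tevalD mulrDr.
Qed.

Lemma tevalM S T a b : teval (S * T) a b = omega S T (comul HA a) (comul HA b).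
Proof.
elim/tens_ind: S => [p1 p2|S S' h h']; last by rewrite mulrDl tevalD omegaS h h'.
elim/tens_ind: T => [q1 q2|T T' h h']; last by rewrite mulrDr tevalD omegaT h h'.
rewrite tensM tevalE !dualME.
elim/tens_ind: (comul HA a) => [u u'|X X' h h']; last first.
  by rewrite omegaDl -h -h' !linearD mulrDl.
elim/tens_ind: (comul HA b) => [v v'|Y Y' h h']; last first.
  by rewrite omegaDr -h -h' !linearD mulrDr.
by rewrite omegaE !tmapE !tmultE !tevalE /= mulrACA.
Qed.

Lemma omega_dcomul phi psi X Y :
  omega (dcomul phi) (dcomul psi) X Y = tmult (tmap phi psi (X * Y)).
Proof.
elim/tens_ind: X => [u u'|X X' h h']; last first.
  by rewrite omegaDl mulrDl !linearD h h'.
elim/tens_ind: Y => [v v'|Y Y' h h']; last first.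
  by rewrite omegaDr mulrDr !linearD h h'.
by rewrite omegaE !dcomulE tensM tmapE tmultE.
Qed.

Lemma dcomul_is_monoid_morphism : monoid_morphism dcomul.
Proof.
split=> [|phi psi]; apply: teval_inj => a b.
  by rewrite dcomulE -tens1 tevalE !dual1E rmorphM.
by rewrite tevalM omega_dcomul dcomulE dualME rmorphM.
Qed.
HB.instance Definition _ :=
  GRing.isMonoidMorphism.Build H (tensor H H) dcomul dcomul_is_monoid_morphism.

Definition dcounit phi : K^o := phi 1.

Lemma dcounit_is_linear : linear dcounit.
Proof. by move=> k phi psi; rewrite /dcounit dualDE dualZE. Qed.
HB.instance Definition _ := GRing.isSemilinear.Build K H K^o _ dcounit
  (GRing.semilinear_linear dcounit_is_linear).

Lemma dcounit_is_monoid_morphism : monoid_morphism dcounit.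
Proof.
split=> [|phi psi]; rewrite /dcounit; first by rewrite dual1E rmorph1.
by rewrite dualME rmorph1 -tens1 tmapE tmultE.
Qed.
HB.instance Definition _ :=
  GRing.isMonoidMorphism.Build H K^o dcounit dcounit_is_monoid_morphism.

Definition dantipode phi : H := linfun (fun a => phi (antipode HA a)).

Lemma dantipodeE phi a : dantipode phi a = phi (antipode HA a).
Proof. by rewrite /dantipode (lfunE (phi \o antipode HA)). Qed.

Lemma dantipode_is_linear : linear dantipode.
Proof.
move=> k phi psi; apply/dualP => a.
by rewrite dualDE dualZE !dantipodeE dualDE dualZE.
Qed.
HB.instance Definition _ := GRing.isSemilinear.Build K H H _ dantipode
  (GRing.semilinear_linear dantipode_is_linear).

Lemma dual_coassoc phi :
  tassoc (tmap dcomul idfun (dcomul phi)) = tmap idfun dcomul (dcomul phi).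
Proof.
apply: contr_inj => a; apply: teval_inj => b c.
transitivity (phi (a * (b * c))).
  rewrite mulrA -dcomulE; elim/tens_ind: (dcomul phi) => [p q|S T h h'].
    rewrite tmapE tevalE -dcomulE /=.
    elim/tens_ind: (dcomul p) => [p1 p2|S T h h'].
      by rewrite tassocE contrE tevalZ !tevalE mulrA.
    by rewrite tensDl !linearD !tevalD mulrDl h h'.
  by rewrite !linearD !tevalD h h'.
rewrite -dcomulE; elim/tens_ind: (dcomul phi) => [p q|S T h h'].
  by rewrite tmapE tevalE contrE tevalZ dcomulE.
by rewrite !linearD !tevalD h h'.
Qed.

Lemma dual_counitl phi : tmap dcounit idfun (dcomul phi) = 1 \ox phi.
Proof.
transitivity ((1 : K^o) \ox contr 1 (dcomul phi)).
  elim/tens_ind: (dcomul phi) => [p q|S T h h'].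
    by rewrite tmapE contrE tensZr -tensZl /dcounit /= -[_ *: _]/(_ * _) mulr1.
  by move: h h'; rewrite !linearD tensDr /= => -> ->.
by congr tens; apply/dualP => a; rewrite -teval_contr dcomulE mul1r.
Qed.

Lemma dual_counitr phi : tmap idfun dcounit (dcomul phi) = phi \ox 1.
Proof.
have tK (T : tensor H K^o) : T = tscale T \ox 1.
  elim/tens_ind: T => [p c|S T h h']; last by rewrite linearD tensDl -h -h'.
  by rewrite tscaleE tensZl -tensZr -[_ *: _]/(_ * _) mulr1.
rewrite [LHS]tK; congr tens; apply/dualP => a.
rewrite -[a in RHS]mulr1 -dcomulE.
elim/tens_ind: (dcomul phi) => [p q|S T h h'].
  by rewrite tmapE tscaleE tevalE dualZE /dcounit /= [LHS]mulrC.
by rewrite !linearD dualDE tevalD h h'.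
Qed.

Let theta (T : tensor H H) : {linear tensor A A -> K^o} :=
  tlift (fun u v => teval T u v : K^o).

Let thetaE T u v : theta T (u \ox v) = teval T u v.
Proof.
rewrite [LHS]tlift_tens //; split=> ?; [exact: teval_linl|exact: teval_linr].
Qed.

Let thetaD S T X : theta (S + T) X = theta S X + theta T X.
Proof.
elim/tens_ind: X => [u v|X Y h h']; first by rewrite !thetaE tevalD.
by rewrite !linearD h h' addrACA.
Qed.

Let theta_dcomul phi X : theta (dcomul phi) X = phi (tmult X).
Proof.
elim/tens_ind: X => [u v|X Y h h']; first by rewrite !thetaE dcomulE tmultE.
by rewrite !linearD h h'.
Qed.

Lemma dual_antipodel phi :
  tmult (tmap dantipode idfun (dcomul phi)) = (dcounit phi)%:A.
Proof.
apply/dualP => a.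
transitivity (theta (dcomul phi) (tmap (antipode HA) idfun (comul HA a))).
  elim/tens_ind: (dcomul phi) => [p q|S T h h']; last first.
    by rewrite thetaD -h -h' !linearD dualDE.
  rewrite tmapE tmultE dualME /=; elim/tens_ind: (comul HA a) => [u v|X Y h h'].
    by rewrite !tmapE thetaE tevalE tmultE /= dantipodeE.
  by move: h h'; rewrite !linearD /= => -> ->.
rewrite theta_dcomul antipodel linearZ dualZE dual1E /dcounit /=.
by rewrite -[LHS]/(_ * _) mulrC.
Qed.

Lemma dual_antipoder phi :
  tmult (tmap idfun dantipode (dcomul phi)) = (dcounit phi)%:A.
Proof.
apply/dualP => a.
transitivity (theta (dcomul phi) (tmap idfun (antipode HA) (comul HA a))).
  elim/tens_ind: (dcomul phi) => [p q|S T h h']; last first.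
    by rewrite thetaD -h -h' !linearD dualDE.
  rewrite tmapE tmultE dualME /=; elim/tens_ind: (comul HA a) => [u v|X Y h h'].
    by rewrite !tmapE thetaE tevalE tmultE /= dantipodeE.
  by move: h h'; rewrite !linearD /= => -> ->.
rewrite theta_dcomul antipoder linearZ dualZE dual1E /dcounit /=.
by rewrite -[LHS]/(_ * _) mulrC.
Qed.

Definition dual_hopf : hopf H :=
  Hopf dual_coassoc dual_counitl dual_counitr dual_antipodel dual_antipoder.

End DualHopf.

(* y |-> mult (1 (x) h) (alpha y) *)
Definition act (K : fieldType) (L A : falgType K) (alpha : L -> tensor L A)
    (h : A -> K^o) (y : L) : L :=
  tscale (tmap idfun h (alpha y)).

Definition in_ideal (R : comNzRingType) (m : nat) (g : 'I_m -> R) (q : R) : Prop :=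
  exists c : 'I_m -> R, q = \sum_(i < m) c i * g i.

(* Main.v *)
From HB Require Import structures.
Require Import Defs.
From mathcomp Require Import all_boot all_order all_algebra all_field.
From mathcomp Require Import qpoly mpoly zify.

Set Implicit Arguments.
Unset Strict Implicit.
Unset Printing Implicit Defensive.

Import GRing.Theory.
Local Open Scope ring_scope.

(* Put q = p^r and N = p^n = q p.  Sending X to 1 (x) t identifies
   Delta(t)^m and alpha(x)^i with powers of X + Y + f W(X, Y), where
   W = \sum_l X^(q l) Y^(q (p - l)) / (l! (p - l)!) is homogeneous of degree N.
   So z_i z_j = C(i + j, i) z_(i + j) whenever i + j < N, and the first effect
   of W is z_q z_(q (p - 1)) = f / (p - 1)! z_1, whence z_q^p = f z_1.  As
   C(j, p^s) is j / p^s (rounded down) mod p, every z_j is a polynomial in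
   z_p, ..., z_q; their truncated monomials are N elements spanning the
   N-dimensional space H, hence a basis.  On L, only W modulo Y^(q + 1) matters,
   and W = X^(q (p - 1)) Y^q / (p - 1)! = - X^(q (p - 1)) Y^q there by Wilson. *)

(** * The algebra K[t]/(t^N) and tensor products with it *)

Section TruncatedPolynomials.
Variables (K : fieldType) (N : nat).
Hypothesis N_gt0 : (0 < N)%N.
Local Notation A := {poly %/ ('X^N : {poly K})}.
Local Notation t := ('qX : A).

Lemma mk_monicXn : mk_monic ('X^N : {poly K}) = 'X^N.
Proof. by rewrite mk_monic_Xn prednK. Qed.

Lemma qXn i : t ^+ i = in_qpoly 'X^N 'X^i.
Proof. by rewrite rmorphXn. Qed.

Lemma qXn_eq0 i : (N <= i)%N -> t ^+ i = 0.
Proof.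
move=> leNi; rewrite -(subnK leNi) exprD [t ^+ N]qXn.
suff -> : in_qpoly ('X^N : {poly K}) 'X^N = 0 by rewrite mulr0.
by apply: val_inj; rewrite /= mk_monicXn Pdiv.RingMonic.rmodpp ?monicXn.
Qed.

Lemma qpoly_sum (a : A) : a = \sum_(i < N) (val a)`_i *: t ^+ i.
Proof.
have sa : (size (val a) <= N)%N.
  by apply: leq_trans (size_npoly a) _; rewrite mk_monicXn size_polyXn.
rewrite {1}(_ : a = in_qpoly 'X^N (val a)); last first.
  by apply/val_inj/esym/in_qpoly_small/size_mk_monic.
have {1}-> : val a = \sum_(i < N) (val a)`_i *: 'X^i.
  rewrite -poly_def; apply/polyP => i; rewrite coef_poly; case: ltnP => //.
  by move=> /(leq_trans sa) /(nth_default 0).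
rewrite linear_sum; apply: eq_bigr => i _.
by rewrite linearZ qXn.
Qed.

Lemma in_qpoly_coef (b : {poly K}) i : (i < N)%N ->
  (val (in_qpoly 'X^N b : A))`_i = b`_i.
Proof.
move=> iN; have mX := monicXn K N.
rewrite /= mk_monicXn [b in RHS](Pdiv.RingMonic.rdivp_eq mX).
by rewrite coefD coefMXn iN add0r.
Qed.

Lemma dim_truncated : \dim {:A} = N.
Proof. by rewrite dim_polyn mk_monicXn size_polyXn. Qed.

Lemma lin_truncated_ext (W : lmodType K) (g h : A -> W) :
  linear g -> linear h -> (forall i, (i < N)%N -> g (t ^+ i) = h (t ^+ i)) -> g =1 h.
Proof.
move=> lg lh gh a.
have lsum (k : A -> W) : linear k ->
    k a = \sum_(i < N) (val a)`_i *: k (t ^+ i).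
  move=> lk; pose kL : {linear A -> W} := HB.pack k
    (GRing.isSemilinear.Build K A W _ k (GRing.semilinear_linear lk)).
  rewrite [a in LHS]qpoly_sum -[k]/(kL : A -> W) linear_sum.
  by apply: eq_bigr => i _; rewrite linearZ.
by rewrite !lsum //; apply: eq_bigr => i _; rewrite gh.
Qed.

Section PolyTensor.
Variable B : falgType K.

Lemma tensl_is_linear : linear (fun b : B => b \ox 1 : tensor B A).
Proof. by move=> k b b'; rewrite tensPl. Qed.
Lemma tensl_is_monoid_morphism : monoid_morphism (fun b : B => b \ox 1 : tensor B A).
Proof. by split=> [|b b'] //=; rewrite tensM mulr1. Qed.

Definition tensl : {rmorphism B -> tensor B A} :=
  HB.pack (fun b : B => b \ox 1 : tensor B A)
    (GRing.isSemilinear.Build K B (tensor B A) _ _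
      (GRing.semilinear_linear tensl_is_linear))
    (GRing.isMonoidMorphism.Build B (tensor B A) _ tensl_is_monoid_morphism).

Lemma comm_tens1X : commr_rmorph tensl (1 \ox t).
Proof. by move=> b; rewrite /GRing.comm /= !tensM !mulr1 !mul1r. Qed.

(** Evaluation at [1 \ox t], coefficients going to the left factor. With [B] the truncated algebra
    it reaches the comultiplication, with [B] the field L the coaction. *)
Definition ptens : {rmorphism {poly B} -> tensor B A} := horner_morph comm_tens1X.

Lemma expr_tens1 i : (1 \ox t : tensor B A) ^+ i = 1 \ox t ^+ i.
Proof. by elim: i => // i IH; rewrite !exprS IH tensM mulr1. Qed.

Lemma ptensCXn b i : ptens (b%:P * 'X^i) = b \ox t ^+ i.
Proof.
rewrite rmorphM rmorphXn [ptens b%:P](horner_morphC comm_tens1X).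
by rewrite [ptens 'X](horner_morphX comm_tens1X) expr_tens1 tensM mulr1 mul1r.
Qed.

Lemma ptensE P : ptens P = \sum_(i < size P) P`_i \ox t ^+ i.
Proof.
rewrite -{1}[P]coefK poly_def rmorph_sum; apply: eq_bigr => i _.
by rewrite -mul_polyC ptensCXn.
Qed.

(* [g] plays the role of [k (x) z_j], with [z_j] the dual basis vector of
   [t ^+ j]. *)
Lemma slice_ptens (W : lmodType K) (g : {linear tensor B A -> W})
    (k : B -> W) (P : {poly B}) j :
  (j < N)%N -> k 0 = 0 ->
  (forall b i, (i < N)%N -> g (b \ox t ^+ i) = if i == j then k b else 0) ->
  g (ptens P) = k P`_j.
Proof.
move=> jN k0 gk; rewrite ptensE linear_sum.
(* The degree of [P] may reach [N]: powers of [t] from [N] on vanish, and such an exponent differs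
   from [j]. *)
have gk' b i : g (b \ox t ^+ i) = if i == j then k b else 0.
  case: (ltnP i N) => [/gk //|Ni]; rewrite qXn_eq0 // tens0r linear0.
  by case: eqP => // ij; lia.
under eq_bigr do rewrite gk'.
case: (ltnP j (size P)) => [jP|Pj]; last first.
  rewrite nth_default // k0 big1 // => i _.
  by case: eqP => // ij; have := ltn_ord i; lia.
rewrite (bigD1 (Ordinal jP)) //= eqxx big1 ?addr0 // => i.
by rewrite -val_eqE /= => /negPf ->.
Qed.

End PolyTensor.
End TruncatedPolynomials.

(** * Binomial coefficients in characteristic p *)

Lemma coef_exprCDX (R : comNzRingType) (x : R) m j :
  ((x%:P + 'X) ^+ m)`_j = x ^+ (m - j) *+ 'C(m, j).
Proof.
rewrite exprDn coef_sum.
have E (i : 'I_m.+1) :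
    ((x%:P ^+ (m - i) * 'X^i) *+ 'C(m, i))`_j
      = if i == j :> nat then x ^+ (m - j) *+ 'C(m, j) else 0.
  rewrite coefMn -polyC_exp coefCM coefXn eq_sym.
  by case: eqP => [->|_]; rewrite ?mulr1 // mulr0 mul0rn.
under eq_bigr do rewrite E.
case: (ltnP j m.+1) => [jm|mj]; last first.
  rewrite bin_small // mulr0n big1 // => i _.
  by case: eqP => // ij; have := ltn_ord i; lia.
rewrite (bigD1 (Ordinal jm)) //= eqxx big1 ?addr0 // => i.
by rewrite -val_eqE /= => /negPf ->.
Qed.

Section CharP.
Variables (p : nat) (K : fieldType).
Hypothesis hp : p \in [pchar K].

Let p_pr : prime p := pcharf_prime hp.

(** A case of Lucas's theorem, read off at X^q with [q = p ^ s]: Frobenius turns (1 + X)^(a q) into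
    (1 + X^q)^a, and the remaining factor has degree below [q]. *)
Lemma natr_bin_expp s j : 'C(j, p ^ s)%:R = (j %/ p ^ s)%:R :> K.
Proof.
have hpK : p \in [pchar {poly K}] by rewrite pchar_poly.
have q0 : (0 < p ^ s)%N by rewrite expn_gt0 prime_gt0.
set q := (p ^ s)%N in q0 *.
have hq : [pchar {poly K}].-nat q.
  by rewrite pnatX (eq_pnat _ (pcharf_eq hpK)) pnat_id.
(* Multiplying by 1 + X^q adds the constant coefficient to that of X^q, so the induction tracks
   both. *)
have coefs a : (((1%:P + 'X : {poly K}) ^+ (a * q + j %% q))`_0 = 1) *
    (((1%:P + 'X : {poly K}) ^+ (a * q + j %% q))`_q = a%:R).
  elim: a => [|a [IH0 IHq]].
    by rewrite mul0n !coef_exprCDX !expr1n bin0 bin_small // ltn_mod.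
  rewrite mulSn -addnA exprD exprDn_pchar // -polyC_exp expr1n mulrDl mul1r.
  rewrite !coefD ['X^q * _]mulrC !coefMXn q0 ltnn subnn IH0 IHq addr0.
  by rewrite -addn1 natrD.
have := (coefs (j %/ q)%N).2; rewrite -divn_eq => <-.
by rewrite coef_exprCDX expr1n.
Qed.

Lemma natr_fact_predp : ((p.-1)`!)%:R = -1 :> K.
Proof.
have := Wilson (prime_gt1 p_pr); rewrite p_pr => /esym.
rewrite (dvdn_pcharf hp) -addn1 natrD addr_eq0 => /eqP ->.
by [].
Qed.

Lemma natr_neq0_ltp j : (0 < j < p)%N -> j%:R != 0 :> K.
Proof.
case/andP=> j0 jp; rewrite -(dvdn_pcharf hp); apply/negP => /(dvdn_leq j0).
by rewrite leqNgt jp.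
Qed.

End CharP.

(** * Order of vanishing at the origin in two variables *)

Section Order.
Variable R : nzRingType.
Implicit Types P Q : {poly {poly R}}.

(** The inner variable is X and the outer one Y, so [P] lies in the [d]-th power of the ideal (X,
    Y). *)
Definition order_ge (d : nat) P := forall i j, (i + j < d)%N -> P`_j`_i = 0.

Lemma order_geD d P Q : order_ge d P -> order_ge d Q -> order_ge d (P + Q).
Proof. by move=> hP hQ i j ij; rewrite !coefD hP ?hQ ?addr0. Qed.

Lemma order_ge_sum d (I : eqType) (s : seq I) (F : I -> {poly {poly R}}) :
  (forall i, i \in s -> order_ge d (F i)) -> order_ge d (\sum_(i <- s) F i).
Proof.
move=> hF; rewrite big_seq; elim/big_rec: _ => [i j _|i P si hP].
  by rewrite !coef0.
by apply: order_geD hP; apply: hF.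
Qed.

Lemma order_geM d e P Q : order_ge d P -> order_ge e Q -> order_ge (d + e) (P * Q).
Proof.
move=> hP hQ i j ij; rewrite coefM coef_sum big1 // => [[k /= kj]] _.
rewrite coefM big1 // => [[l /= li]] _.
case: (ltnP (l + k) d) => [/hP -> //|lk]; first by rewrite mul0r.
by rewrite (hQ (i - l)%N (j - k)%N) ?mulr0 //; lia.
Qed.

Lemma order_geX d P k : order_ge d P -> order_ge (k * d) (P ^+ k).
Proof.
by move=> hP; elim: k => // k IH; rewrite exprS mulSn; apply: order_geM.
Qed.

End Order.

(** * Coefficients of powers of X + Y + f W *)

Section Correction.
Variables (p : nat) (K : fieldType) (q : nat) (f : K).
Hypothesis hp : p \in [pchar K].
Hypothesis q_gt0 : (0 < q)%N.

Let p_gt1 : (1 < p)%N := prime_gt1 (pcharf_prime hp).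

Definition cocycle_coef l : K := f * ((l`! * (p - l)`!)%N%:R)^-1.

(** Up to the factor [f], this is the Witt vector addition polynomial (X^p + Y^p - (X + Y)^p) / p,
    reduced mod [p] and taken at [q]-th powers. Leaving [x] free lets one formula serve for X, [t]
    and the generator of L. *)
Definition cocycle (B : algType K) (x : B) : {poly B} :=
  \sum_(1 <= l < p) (cocycle_coef l *: x ^+ (q * l))%:P * 'X^(q * (p - l)).

Definition comul_poly (B : algType K) (x : B) : {poly B} :=
  x%:P + 'X + cocycle x.

Lemma cocycle_coef_predp : cocycle_coef p.-1 = - f.
Proof.
have p1 : (p - p.-1 = 1)%N by lia.
by rewrite /cocycle_coef p1 muln1 (natr_fact_predp hp) invrN1 mulrN1.
Qed.

Lemma map_comul_poly (B C : algType K) (g : {lrmorphism B -> C}) x :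
  map_poly g (comul_poly x) = comul_poly (g x).
Proof.
rewrite /comul_poly !rmorphD /= map_polyC map_polyX rmorph_sum; congr (_ + _).
apply: eq_bigr => l _.
by rewrite rmorphM /= map_polyC /= map_polyXn linearZ rmorphXn.
Qed.

Lemma coef_cocycle (B : algType K) (x : B) j :
  (cocycle x)`_j =
    \sum_(1 <= l < p | j == (q * (p - l))%N) cocycle_coef l *: x ^+ (q * l).
Proof.
rewrite coef_sum [RHS]big_mkcond /=; apply: eq_bigr => l _.
by rewrite coefCM coefXn; case: eqP => _; rewrite ?mulr1 ?mulr0.
Qed.

Lemma order_cocycle : order_ge (q * p) (cocycle ('X : {poly K})).
Proof.
move=> i j ij; rewrite coef_cocycle coef_sum big_seq_cond big1 // => l.
rewrite mem_index_iota => /andP[/andP[l1 lp] /eqP jl].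
rewrite coefZ coefXn; case: eqP => [il|_]; last by rewrite mulr0.
move: ij; rewrite il jl -mulnDr subnKC ?ltnn //; exact: ltnW.
Qed.

(** The difference between the [m]-th powers of [comul_poly 'X] and of X + Y is the cocycle times a
    sum of products of [m.-1] factors of order 1. It starts in degree [q * p + m.-1], below which
    only the binomial expansion is seen. *)
Lemma coef_comul_poly_exp m i j : (i + j < (q * p) + m.-1)%N ->
  ((comul_poly 'X ^+ m)`_j)`_i = if (i + j == m)%N then 'C(m, i)%:R else 0 :> K.
Proof.
move=> ij; set S := ('X : {poly K})%:P + 'X.
have SmE : (S ^+ m)`_j`_i = if (i + j == m)%N then 'C(m, i)%:R else 0.
  rewrite coef_exprCDX coefMn coefXn.
  case: eqP => [im|im]; case: eqP => [ijm|ijm] //.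
  - by rewrite -ijm -[X in 'C(_, X)](addKn i) bin_sub ?leq_addr.
  - by rewrite bin_small //; lia.
  - by lia.
  - by rewrite mul0rn.
rewrite -SmE; apply/eqP; rewrite -subr_eq0 -!coefB; apply/eqP.
have oS : order_ge 1 S.
  move=> [|//] [|//] _; rewrite coefD coefC coefX /= addr0.
  by rewrite coefX.
have oP : order_ge 1 (comul_poly 'X : {poly {poly K}}).
  apply: order_geD oS _ => a b ab; apply: order_cocycle.
  by apply: leq_trans ab _; rewrite muln_gt0 q_gt0 ltnW.
rewrite subrXX addrC addKr; apply: (order_geM order_cocycle _ ij).
apply: order_ge_sum => k _.
have := ltn_ord k => km.
have := order_geM (order_geX oP (k := (m.-1 - k)%N)) (order_geX oS (k := k)).
by rewrite !muln1 subnK //; lia.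
Qed.

Lemma coef_comul_poly l : (1 <= l < p)%N ->
  ((comul_poly ('X : {poly K}))`_(q * (p - l)))`_(q * l) = cocycle_coef l.
Proof.
move=> /andP[l1 lp].
have qpl : (0 < q * (p - l))%N by rewrite muln_gt0 q_gt0 subn_gt0.
have ql : (0 < q * l)%N by rewrite muln_gt0 q_gt0.
rewrite !coefD coefC coefX coef_cocycle (gtn_eqF qpl) coef0 add0r coefMn.
rewrite coefC (gtn_eqF ql) mul0rn add0r big_mkcond /=.
rewrite (bigD1_seq l) ?iota_uniq ?mem_index_iota ?l1 //= eqxx.
rewrite coefD coefZ coefXn eqxx mulr1 coef_sum big_seq_cond big1 ?addr0 // => k.
rewrite mem_index_iota => /andP[/andP[k1 kp] /eqP kl].
case: eqP => [/eqP|_]; last by rewrite coef0.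
by rewrite eqn_pmul2l // => /eqP kpl; case: kl; lia.
Qed.

(** Up to degree [q] in Y the cocycle has the single term l = p - 1, a multiple of Y^q. Its cofactor
    in [P ^ m - S ^ m] then enters only through its constant term in Y, a sum of [m] copies of
    [x ^+ m.-1]. *)
Lemma coef_comul_poly_exp_le (B : comAlgType K) (x : B) m j : (j <= q)%N ->
  ((comul_poly x) ^+ m)`_j =
    x ^+ (m - j) *+ 'C(m, j) +
    (if j == q then - (f *: x ^+ (q * p.-1 + m.-1)) *+ m else 0).
Proof.
move=> jq; set P := comul_poly x; set S := x%:P + 'X : {poly B}.
have Vcoef k : (k <= q)%N ->
    (cocycle x)`_k = if k == q then - (f *: x ^+ (q * p.-1)) else 0.
  move=> kq; rewrite coef_cocycle big_mkcond big_seq /=.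
  rewrite (eq_bigr (fun l => if (k == q) && (l == p.-1)
      then - (f *: x ^+ (q * p.-1)) else 0)) => [|l]; last first.
    rewrite mem_index_iota => /andP[l1 lp].
    case: eqP => [kl|kl].
      have pl : (p - l = 1)%N.
        by apply/eqP; rewrite eqn_leq subn_gt0 lp -(leq_pmul2l q_gt0) muln1 -kl kq.
      rewrite {1}kl pl muln1 eqxx; have -> : l = p.-1 by lia.
      by rewrite eqxx cocycle_coef_predp scaleNr.
    by case: eqP => [kq1|//]; case: eqP => // lp1; case: kl; rewrite lp1; lia.
  rewrite -big_seq; case: eqP => _; last by rewrite big1_eq.
  rewrite (bigD1_seq p.-1) ?iota_uniq ?mem_index_iota //=; last by lia.
  by rewrite eqxx big1 ?addr0 // => l /negPf ->.
have V0 : (cocycle x)`_0 = 0 by rewrite Vcoef // ltn_eqF.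
have -> : P ^+ m = S ^+ m + (P ^+ m - S ^+ m) by rewrite addrC subrK.
rewrite coefD coef_exprCDX subrXX; congr (_ + _).
rewrite /P /comul_poly -/S addrC addKr coefM.
(* The cocycle has no term below Y^q, so only the last index of the convolution can survive, and
   only for [j = q]. *)
rewrite (eq_bigr (fun k : 'I_j.+1 => if k == ord_max then
  if j == q then - (f *: x ^+ (q * p.-1 + m.-1)) *+ m else 0 else 0)) => [|k _].
  by rewrite -big_mkcond big_pred1_eq.
rewrite Vcoef; last by have := ltn_ord k; lia.
rewrite -val_eqE /=; case: eqP => kq; last first.
  by rewrite mul0r; case: eqP => // kj; case: eqP => // jq1; case: kq; lia.
have jq1 : j = q by have := ltn_ord k; lia.
rewrite kq jq1 eqxx subnn -horner_coef0 horner_sum.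
rewrite (eq_bigr (fun=> x ^+ m.-1)) => [|i _].
  by rewrite sumr_const card_ord mulrnAr mulNr -scalerAl -exprD.
rewrite !(hornerM, horner_exp) !hornerD hornerC hornerX.
rewrite [(cocycle x).[0]]horner_coef0 V0 !addr0.
by rewrite -exprD subnK //; have := ltn_ord i; lia.
Qed.

End Correction.

Lemma ptens_comul_poly (p : nat) (K : fieldType) (N q : nat) (f : K)
    (B : falgType K) (x : B) :
  ptens N B (comul_poly p q f x) = x \ox 1 + 1 \ox 'qX
    + f *: \sum_(1 <= l < p) ((l`! * (p - l)`!)%N%:R)^-1
             *: (x ^+ (q * l) \ox 'qX ^+ (q * (p - l))).
Proof.
rewrite !rmorphD rmorph_sum scaler_sumr /=; congr (_ + _ + _).
- by have := ptensCXn N x 0; rewrite mulr1.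
- by have := ptensCXn N (1 : B) 1; rewrite mul1r.
by apply: eq_bigr => l _; rewrite ptensCXn tensZl scalerA.
Qed.

(** * The dual algebra: products, generators, commutativity *)

Section DualAlgebra.
Variables (p : nat) (K : fieldType) (r : nat) (f : K).
Hypothesis hp : p \in [pchar K].
Local Notation N := (p ^ r.+1)%N.
Local Notation q := (p ^ r)%N.
Local Notation A := {poly %/ ('X^N : {poly K})}.
Local Notation t := ('qX : A).
Variable HA : hopf A.
Hypothesis hcomul : comul HA t = t \ox 1 + 1 \ox t
       + f *: \sum_(1 <= l < p) ((l`! * (p - l)`!)%N%:R)^-1
                *: (t ^+ (q * l) \ox t ^+ (q * (p - l))).
Hypothesis hcounit : counit HA t = 0.
Variable z : nat -> dual HA.
Hypothesis hz : forall j i : nat, (j < N)%N -> (i < N)%N ->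
  z j (t ^+ i) = (i == j)%:R.

Let p_pr : prime p := pcharf_prime hp.
Let p_gt1 : (1 < p)%N := prime_gt1 p_pr.
Let q_gt0 : (0 < q)%N. Proof. by rewrite expn_gt0 prime_gt0. Qed.
Let N_gt0 : (0 < N)%N. Proof. by rewrite expn_gt0 prime_gt0. Qed.

Lemma dual_ext (phi psi : dual HA) :
  (forall i, (i < N)%N -> phi (t ^+ i) = psi (t ^+ i)) -> phi = psi.
Proof.
move=> pq; apply/dualP => a.
apply: (lin_truncated_ext N_gt0 (W := K^o) (g := phi) (h := psi)) => //;
  exact: linearP.
Qed.

Lemma z_coef j (a : A) : (j < N)%N -> z j a = (val a)`_j.
Proof.
move=> jN; rewrite {1}(qpoly_sum N_gt0 a) linear_sum (bigD1 (Ordinal jN)) //=.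
rewrite linearZ /= hz // eqxx big1 => [|i].
  by rewrite addr0 [LHS]mulr1.
by rewrite -val_eqE /= => /negPf ij; rewrite linearZ /= hz // ij scaler0.
Qed.

Lemma dual_sum (h : dual HA) : h = \sum_(j < N) (h (t ^+ j) : K) *: z j.
Proof.
apply: dual_ext => i iN; rewrite sum_lfunE (bigD1 (Ordinal iN)) //=.
rewrite dualZE hz // eqxx [_ *: _]mulr1 big1 ?addr0 // => j.
rewrite -val_eqE /= => /negPf ji; rewrite dualZE hz //.
by rewrite eq_sym ji [LHS]mulr0.
Qed.

Lemma dim_dual : \dim {:dual HA} = N.
Proof.
by rewrite dimvf /= -[RHS](dim_truncated K N_gt0) [in RHS]dimvf [LHS]muln1.
Qed.

(** The comultiplication of the dual is the transpose of the product, so both sides are compared on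
    pairs of powers of [t]; only the summand of index [j] can survive. *)
Lemma dcomul_z k : (k < N)%N ->
  comul (dual_hopf HA) (z k) = \sum_(0 <= i < k.+1) z (k - i)%N \ox z i.
Proof.
move=> kN; apply: teval_inj => a b; move: a.
apply: (lin_truncated_ext N_gt0 (W := K^o)) => [||i iN]; try exact: teval_linl.
move: b; apply: (lin_truncated_ext N_gt0 (W := K^o)) => [||j jN];
  try exact: teval_linr.
have teval_sum (s : seq nat) F :
      teval (\sum_(l <- s) F l : tensor (dual HA) (dual HA)) (t ^+ i) (t ^+ j)
    = \sum_(l <- s) teval (F l) (t ^+ i) (t ^+ j).
  elim/big_rec2: _ => [|l y T _ <-]; first by rewrite -(scale0r 0) tevalZ mul0r.
  by rewrite tevalD.
rewrite dcomulE -exprD teval_sum.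
rewrite (eq_big_nat _ _ (F2 := fun l => if l == j then (i + j == k)%:R else 0))
    => [|l lk]; last first.
  rewrite tevalE !hz //; [|by lia|by lia].
  rewrite [j == l]eq_sym; case: (eqVneq l j) lk => [->|_] lk; last by rewrite mulr0.
  by rewrite mulr1; congr ((nat_of_bool _)%:R); apply/eqP/eqP; lia.
(* When i + j reaches [N], the power of [t] vanishes and [i + j = k] fails because [k < N]. *)
rewrite -big_mkcond /=; case: (ltnP (i + j) N) => [ijN|Nij]; last first.
  rewrite qXn_eq0 // linear0 big1 // => _ _.
  by rewrite gtn_eqF // (leq_trans kN).
rewrite hz //; case: eqP => ijk; last by rewrite big1.
by rewrite big_nat1_eq -ijk leq0n ltnS leq_addl.
Qed.

Lemma act_z (L : fieldExtType K) (x : L) (alpha : {lrmorphism L -> tensor L A}) :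
  alpha x = x \ox 1 + 1 \ox t
    + f *: \sum_(1 <= l < p) ((l`! * (p - l)`!)%N%:R)^-1
             *: (x ^+ (q * l) \ox t ^+ (q * (p - l))) ->
  forall i j, (j < N)%N ->
    act alpha (z j) (x ^+ i) = ((comul_poly p q f x ^+ i)`_j : L).
Proof.
move=> hx i j jN.
have aXn : alpha (x ^+ i) = ptens N L (comul_poly p q f x ^+ i).
  by rewrite rmorphXn [ptens _ _ _]rmorphXn ptens_comul_poly -hx.
rewrite /act aXn.
pose g : {linear tensor L A -> L} := @tscale _ _ \o tmap idfun (z j).
rewrite -[LHS]/(g _) (slice_ptens N_gt0 (k := id) _ jN) // => b k kN.
have -> : g (b \ox t ^+ k) = (z j (t ^+ k) : K) *: b.
  by rewrite /g /= tmapE tscaleE.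
by rewrite (hz jN kN); case: eqP => _; rewrite ?scale1r ?scale0r.
Qed.

Lemma zM_coef i j m : (i < N)%N -> (j < N)%N ->
  (z i * z j) (t ^+ m) = ((comul_poly p q f ('X : {poly K}) ^+ m)`_j)`_i.
Proof.
have comulXn : comul HA (t ^+ m) = ptens N A (comul_poly p q f t ^+ m).
  by rewrite rmorphXn [ptens _ _ _]rmorphXn ptens_comul_poly -hcomul.
move=> iN jN; rewrite dualME comulXn.
pose g : {linear tensor A A -> K^o} := @tmult _ _ \o tmap (z i) (z j).
rewrite -[LHS]/(g (ptens N A (comul_poly p q f t ^+ m))).
rewrite (slice_ptens N_gt0 (k := z i) _ jN) ?linear0 //; last first.
  move=> b k kN; rewrite /g /= tmapE tmultE /= hz //.
  by case: eqP; rewrite ?mulr1 ?mulr0.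
(* The coefficient is computed in [{poly K}] and then reduced mod X^N, which does not affect degree
   [i < N]. *)
pose iq : {lrmorphism {poly K} -> A} := in_qpoly 'X^N.
have -> : comul_poly p q f t = map_poly iq (comul_poly p q f 'X).
  by rewrite map_comul_poly.
by rewrite -rmorphXn coef_map z_coef // in_qpoly_coef.
Qed.

Lemma NE : (q * p = N)%N. Proof. by rewrite expnSr. Qed.

Lemma z0 : z 0 = 1.
Proof.
apply: dual_ext => i iN; rewrite hz // dual1E [RHS]rmorphXn.
by rewrite [X in X ^+ _]hcounit expr0n.
Qed.

Lemma zM i j : (i + j < N)%N -> z i * z j = 'C(i + j, i)%:R *: z (i + j).
Proof.
move=> ijN; apply: dual_ext => m mN.
have iN : (i < N)%N by lia. have jN : (j < N)%N by lia.
rewrite zM_coef // coef_comul_poly_exp // ?NE; last by lia.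
rewrite dualZE hz //= eq_sym; case: eqP => [->|_]; by rewrite ?[RHS]mulr1 ?[RHS]mulr0.
Qed.

(** The indices add up to [N], one past the range of [zM]. At [m = 1] the term l = 1 of the cocycle
    gives f / (p - 1)!. For [m] at least 2 the order bound still applies, and a nonzero value would
    need [m = N]. *)
Lemma zM_top : z q * z (q * p.-1) = (p.-1)`!%:R^-1 *: (f *: z 1).
Proof.
apply: dual_ext => m mN.
have qN : (q < N)%N by rewrite -NE ltn_Pmulr.
have qpN : (q * p.-1 < N)%N by rewrite -NE ltn_pmul2l // prednK // ltnW.
have N1 : (1 < N)%N by lia.
have p1_gt0 : (0 < p.-1)%N by lia.
have qpE : (q + q * p.-1 = N)%N by rewrite -mulnS prednK ?NE // ltnW.
rewrite zM_coef // !dualZE hz //.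
case: (eqVneq m 1%N) => [->|m1].
  rewrite expr1; have := coef_comul_poly f hp q_gt0 (l := 1) p_gt1.
  rewrite muln1 subn1 => ->; rewrite /cocycle_coef mul1n subn1 mulrC.
  by rewrite [in RHS]/GRing.scale /= mulr1.
rewrite !scaler0; case: m => [|m] in mN m1 *.
  by rewrite expr0 coefC gtn_eqF ?muln_gt0 ?q_gt0 // coef0.
rewrite coef_comul_poly_exp // ?NE qpE; last by lia.
by rewrite gtn_eqF.
Qed.

(** Divided power relations: by [natr_bin_expp] each new factor contributes the binomial coefficient
    k + 1. *)
Lemma zX s k : (k * p ^ s < N)%N -> z (p ^ s) ^+ k = k`!%:R *: z (k * p ^ s).
Proof.
elim: k => [|k IH] kN; first by rewrite scale1r z0.
have kN' : (k * p ^ s < N)%N by apply: leq_ltn_trans kN; rewrite mulSn leq_addl.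
rewrite exprS IH // -scalerAr zM -?mulSn // scalerA; congr (_ *: _).
rewrite (natr_bin_expp hp) mulnK ?expn_gt0 ?prime_gt0 //.
by rewrite -natrM mulnC -factS.
Qed.

Lemma zXp_eq0 s : (s < r)%N -> z (p ^ s) ^+ p = 0.
Proof.
move=> sr; rewrite zX.
  have /eqP -> : p`!%:R == 0 :> K.
    by rewrite -(dvdn_pcharf hp) dvdn_fact // prime_gt0 //=.
  by rewrite scale0r.
by rewrite -expnS ltn_exp2l.
Qed.

(** As [q * p = N], [zX] reaches only the exponent [p.-1]; [zM_top] handles the last factor, and the
    two factorials cancel. *)
Lemma zqXp : z q ^+ p = f *: z 1.
Proof.
have qN : (p.-1 * q < N)%N by rewrite mulnC -NE ltn_pmul2l // prednK // ltnW.
have fact0 : (p.-1)`!%:R != 0 :> K by rewrite natr_fact_predp // oppr_eq0 oner_eq0.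
rewrite (_ : z q ^+ p = z q ^+ p.-1.+1); last by rewrite prednK // ltnW.
rewrite exprS zX // -scalerAr mulnC zM_top.
by rewrite scalerA divff // scale1r.
Qed.

Hypothesis r_gt0 : (0 < r)%N.

Lemma zqXpp_eq0 : z q ^+ (p ^ 2) = 0.
Proof.
have z1p := zXp_eq0 r_gt0.
by rewrite -mulnn exprM zqXp exprZn z1p scaler0.
Qed.

Hypothesis f_neq0 : f != 0.

(** Generation of the dual algebra by z_p, ..., z_q, phrased as an induction principle; it yields
    both commutativity and surjectivity of the presentation. *)
Lemma dual_ind (P : dual HA -> Prop) :
  P 1 -> (forall g h, P g -> P h -> P (g * h)) ->
  (forall (k : K) g h, P g -> P h -> P (k *: g + h)) ->
  (forall s, (0 < s <= r)%N -> P (z (p ^ s))) -> forall h, P h.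
Proof.
move=> P1 PM PL Pz.
have P0 : P 0 by have := PL (-1) 1 1 P1 P1; rewrite scaleN1r addNr.
have PZ k g : P g -> P (k *: g) by move=> /PL/(_ P0) => /(_ k); rewrite addr0.
have PD g h : P g -> P h -> P (g + h) by move=> Pg /(PL 1 _ _ Pg); rewrite scale1r.
have PX g k : P g -> P (g ^+ k).
  by move=> Pg; elim: k => // k; rewrite exprS; apply: PM.
have Pzs s : (s <= r)%N -> P (z (p ^ s)).
  case: s => [_|s sr]; last exact: Pz.
  (* [z 1] is not among the generators and is recovered from [zqXp], using that [f] is
     invertible. *)
  rewrite expn0 -[z 1]scale1r -(mulVf f_neq0) -scalerA -zqXp.
  by apply/PZ/PX/Pz; rewrite r_gt0 leqnn.
have Pzj j : (j < N)%N -> P (z j).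
  elim/ltn_ind: j => j IH jN; case: (posnP j) => [->|j_gt0]; first by rewrite z0.
  have /andP[lej ltj] := trunc_log_bounds p_gt1 j_gt0.
  set s := trunc_log p j in lej ltj.
  have ps0 : (0 < p ^ s)%N by rewrite expn_gt0 prime_gt0.
  (* By the choice of [s] this binomial coefficient is the leading base [p] digit of [j], hence
     invertible in [K]. *)
  have bin0 : 'C(j, p ^ s)%:R != 0 :> K.
    rewrite (natr_bin_expp hp) (natr_neq0_ltp hp) //.
    by rewrite divn_gt0 // lej ltn_divLR // -expnS.
  have sr : (s <= r)%N by rewrite -ltnS -(ltn_exp2l _ _ p_gt1) (leq_ltn_trans lej).
  rewrite -[z j]scale1r -(mulVf bin0) -scalerA.
  rewrite -{2 3}(subnKC lej) -zM; last by rewrite subnKC.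
  by apply/PZ/PM; [exact: Pzs | apply: IH; lia].
move=> h; rewrite [h]dual_sum; elim/big_rec: _ => // i g _ Pg.
by apply: PL => //; apply: Pzj.
Qed.

(** The elements commuting with a given one form a subalgebra, so [dual_ind] in both arguments
    leaves pairs of generators, where [zM] is symmetric. *)
Lemma dualC (g h : dual HA) : g * h = h * g.
Proof.
have zMC i j : (i + j < N)%N -> z i * z j = z j * z i.
  move=> ij; rewrite !zM //; last by rewrite addnC.
  by rewrite -[in LHS](bin_sub (leq_addr j i)) addKn addnC.
have comm_lt s s' : (s < s' <= r)%N ->
    z (p ^ s) * z (p ^ s') = z (p ^ s') * z (p ^ s).
  case/andP=> ss' s'r; apply: zMC.
  have lts : (p ^ s < p ^ s')%N by rewrite ltn_exp2l.
  have les : (p ^ s' <= q)%N by rewrite leq_exp2l.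
  (* Two distinct generators have indices adding up to less than 2 q, so [zM] applies. *)
  have : (q * 2 <= N)%N by rewrite -NE leq_mul2l p_gt1 orbT.
  by lia.
have comm_z s h' : (0 < s <= r)%N -> GRing.comm h' (z (p ^ s)).
  move=> /andP[s0 sr]; elim/dual_ind: h'
    => [|g1 g2 c1 c2|k g1 g2 c1 c2|s' /andP[s'0 s'r]].
  - exact/commr_sym/commr1.
  - exact/commr_sym/commrM/commr_sym/c2/commr_sym/c1.
  - by rewrite /GRing.comm mulrDl mulrDr -scalerAl -scalerAr c1 c2.
  - case: (ltngtP s s') => [ss'|s's|-> //].
    + by apply/esym/comm_lt; rewrite ss' s'r.
    + by apply: comm_lt; rewrite s's sr.
elim/dual_ind: h => [|g1 g2 c1 c2|k g1 g2 c1 c2|s sr].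
- by rewrite mulr1 mul1r.
- by rewrite mulrA c1 -mulrA c2 mulrA.
- by rewrite mulrDl mulrDr -scalerAl -scalerAr c1 c2.
- exact: comm_z.
Qed.

End DualAlgebra.

(** * Base p digits *)

Lemma digit_modn (p r s : nat) (d : nat -> nat) : (0 < p)%N -> (s <= r)%N ->
  (forall l, (l <= r)%N -> (d l < p)%N) ->
  ((\sum_(0 <= l < r.+1) d l * p ^ l) %/ p ^ s = d s %[mod p])%N.
Proof.
move=> p0 sr dp.
have low k : (k <= r.+1)%N -> (\sum_(0 <= l < k) d l * p ^ l < p ^ k)%N.
  elim: k => [|k IH] kr; first by rewrite big_nil.
  rewrite big_nat_recr //= expnS; apply: leq_trans (_ : p ^ k + d k * p ^ k <= _)%N.
    by rewrite -addSn leq_add2r; apply/IH/ltnW.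
  by rewrite -mulSn leq_mul2r dp ?orbT.
have pks k : (0 < p ^ k)%N by rewrite expn_gt0 p0.
rewrite (big_cat_nat (n := s)) //=; last exact: leqW.
(* The terms from [s] on are [p ^ s] times a number congruent to [d s]; the earlier ones add up to
   less than [p ^ s]. *)
have -> : (\sum_(s <= l < r.+1) d l * p ^ l =
    (d s + p * \sum_(s <= l < r) d l.+1 * p ^ (l - s)) * p ^ s)%N.
  rewrite big_nat_recl // mulnDl; congr addn.
  rewrite mulnAC -expnS mulnC big_distrl /=; apply: eq_big_nat => l /andP[sl lr].
  by rewrite -mulnA -expnD; congr (_ * p ^ _)%N; lia.
by rewrite addnC divnMDl // divn_small ?low ?leqW // addn0 addnC mulnC modnMDl.
Qed.

Lemma natr_bin_digit (p r s : nat) (K : fieldType) (d : nat -> nat) :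
  p \in [pchar K] -> (s <= r)%N -> (forall l, (l <= r)%N -> (d l < p)%N) ->
  'C(\sum_(0 <= l < r.+1) d l * p ^ l, p ^ s)%:R = (d s)%:R :> K.
Proof.
move=> hp sr dp; have p0 := prime_gt0 (pcharf_prime hp).
have natr_mod m : m%:R = (m %% p)%:R :> K.
  by rewrite {1}(divn_eq m p) natrD natrM (pcharf0 hp) mulr0 add0r.
by rewrite (natr_bin_expp hp) natr_mod digit_modn // -natr_mod.
Qed.

(** * Presentations by truncated polynomials *)

Section TruncatedPresentation.
Variables (K : fieldType) (r : nat) (H : falgType K).

(** The type of [H] is not commutative, so multiplicativity of evaluation rests on the commutation
    hypothesis. *)
Lemma mpoly_eval (w : 'I_r -> H) :
  (forall i h, GRing.comm h (w i)) ->
  exists pi : {lrmorphism {mpoly K[r]} -> H}, forall i, pi 'X_i = w i.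
Proof.
move=> cw; pose ev := mmap (GRing.in_alg H) w.
have ev_lin : linear ev.
  by move=> k a b; rewrite /ev mmapD mmapZ /= mulr_algl.
have ev_mul : monoid_morphism ev.
  have calg (a : {mpoly K[r]}) m m' : GRing.comm (GRing.in_alg H a@_m) (mmap1 w m').
    by rewrite /GRing.comm /= mulr_algl mulr_algr.
  by have [evM ev1] := commr_mmap_is_multiplicative cw calg.
pose pi : {lrmorphism {mpoly K[r]} -> H} := HB.pack ev
  (GRing.isSemilinear.Build K {mpoly K[r]} H _ ev (GRing.semilinear_linear ev_lin))
  (GRing.isMonoidMorphism.Build {mpoly K[r]} H ev ev_mul).
by exists pi => i; rewrite /pi /= /ev mmapX mmap1U.
Qed.

Variables (e : 'I_r -> nat).
Local Notation I := (in_ideal (fun s : 'I_r => 'X_s ^+ e s : {mpoly K[r]})).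

Lemma in_ideal_lin (k : K) a b : I a -> I b -> I (k *: a + b).
Proof.
case=> [ca ->] [cb ->]; exists (fun s => k *: ca s + cb s).
rewrite scaler_sumr -big_split; apply: eq_bigr => s _.
by rewrite mulrDl -scalerAl.
Qed.

Lemma in_ideal0 : I 0.
Proof. by exists (fun=> 0); rewrite big1 // => s _; rewrite mul0r. Qed.

Lemma in_ideal_mnm (m : 'X_{1..r}) s : (e s <= m s)%N -> I 'X_[m].
Proof.
move=> em; exists (fun s' => if s' == s then 'X_[m - U_(s) *+ e s] else 0).
rewrite (bigD1 s) //= eqxx big1 => [|s' /negPf ->]; last by rewrite mul0r.
rewrite addr0 mpolyXn -mpolyXD submK //; apply/mnm_lepP => i.
rewrite mulmnE mnm1E; case: eqP => [<-|_]; by rewrite ?mul1n.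
Qed.

(** Exponent vectors below [e]; enumerating them gives the truncated monomials ordinal indices, as
    [freeP] requires. *)
Local Notation G := {dffun forall s : 'I_r, 'I_(e s)}.
Let mon (i : 'I_#|{: G}|) : {mpoly K[r]} :=
  'X_[[multinom (enum_val i s : nat) | s < r]].

(** Each monomial either has an exponent reaching [e s], and lies in the ideal, or is one of the
    [mon i]. *)
Lemma in_ideal_reduce q : exists c, I (q - \sum_i c i *: mon i).
Proof.
rewrite (mpolyE q); elim/big_rec: _ => [|m q' _ [c hc]].
  exists (fun=> 0); rewrite big1 => [|i _]; last by rewrite scale0r.
  by rewrite subr0; apply: in_ideal0.
have [/existsP [s em]|/existsPn lt_me] := boolP [exists s, e s <= m s]%N.
  by exists c; rewrite -addrA; apply: in_ideal_lin hc; apply: in_ideal_mnm em.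
have ltm s : (m s < e s)%N by rewrite ltnNge lt_me.
pose g : G := [ffun s => Ordinal (ltm s)].
have mon_g : mon (enum_rank g) = 'X_[m].
  by congr 'X_[_]; apply/mnmP => s; rewrite mnmE enum_rankK ffunE.
exists (fun i => (if i == enum_rank g then q@_m else 0) + c i).
under eq_bigr do rewrite scalerDl.
have mE : \sum_i (if i == enum_rank g then q@_m else 0) *: mon i = q@_m *: 'X_[m].
  rewrite (bigD1 (enum_rank g)) //= eqxx mon_g big1 ?addr0 // => i /negPf ->.
  by rewrite scale0r.
by rewrite big_split /= mE opprD addrACA subrr add0r.
Qed.

(** The images of the truncated monomials span [H] and number exactly its dimension, so they are
    free; a kernel element therefore reduces to 0 modulo the ideal. *)
Lemma mpoly_truncated_kernel (pi : {lrmorphism {mpoly K[r]} -> H}) :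
  (forall h, exists q, pi q = h) -> (forall s, pi 'X_s ^+ e s = 0) ->
  \dim {:H} = (\prod_s e s)%N -> forall q, pi q = 0 <-> I q.
Proof.
move=> pi_surj pi_e dimH.
have piI q : I q -> pi q = 0.
  case=> c ->; rewrite rmorph_sum big1 // => s _.
  by rewrite rmorphM rmorphXn /= pi_e mulr0.
have pi_red q : exists2 c,
    I (q - \sum_i c i *: mon i) & pi q = \sum_i c i *: pi (mon i).
  have [c Ic] := in_ideal_reduce q; exists c => //.
  have := piI _ Ic; rewrite linearB linear_sum => /subr0_eq ->.
  by apply: eq_bigr => i _; rewrite linearZ.
have cardG : #|{: G}| = \dim {:H}.
  rewrite dimH card_dep_ffun foldrE big_map enumT.
  by apply: eq_bigr => s _; rewrite card_ord.
pose X := [tuple pi (mon i) | i < #|{: G}|].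
have nthX (i : 'I_#|{: G}|) : X`_i = pi (mon i) by rewrite -tnth_nth tnth_mktuple.
have freeX : free X.
  apply: (@basis_free _ _ fullv); rewrite basisEdim size_tuple -cardG leqnn andbT.
  apply/subvP => h _; have [q <-] := pi_surj h; have [c _ ->] := pi_red q.
  apply: memv_suml => i _; apply/memvZ/memv_span.
  by rewrite -nthX mem_nth // size_tuple.
move=> q; split=> [piq|]; last exact: piI.
have [c Ic piqE] := pi_red q.
move/freeP: freeX => /(_ c); under eq_bigr do rewrite nthX.
rewrite -piqE => /(_ piq) c0.
by move: Ic; rewrite big1 ?subr0 // => i _; rewrite c0 scale0r.
Qed.

End TruncatedPresentation.

Theorem theorem5p9 (p : nat) (K : fieldType) (hp : p \in [pchar K])
    (n : nat) (hn : (2 <= n)%N) (r : nat) (hr : r = n.-1)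
    (f : K) (hf : f != 0)
    (HA : hopf {poly %/ ('X^(p ^ n) : {poly K})})
    (t : {poly %/ ('X^(p ^ n) : {poly K})}) (ht : t = 'qX)
    (hcomul : comul HA t = t \ox 1 + 1 \ox t
       + f *: \sum_(1 <= l < p) ((l`! * (p - l)`!)%N%:R)^-1
                *: (t ^+ (p ^ r * l) \ox t ^+ (p ^ r * (p - l))))
    (hcounit : counit HA t = 0)
    (hantipode : antipode HA t = - t)
    (z : nat -> dual HA)
    (hz : forall j i : nat, (j < p ^ n)%N -> (i < p ^ n)%N ->
            z j (t ^+ i) = (i == j)%:R) :
  (exists pi : {lrmorphism {mpoly K[r]} -> dual HA},
     [/\ forall s : 'I_r, pi 'X_s = z (p ^ s.+1)%N,
         forall h : dual HA, exists q, pi q = h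
       & forall q, pi q = 0 <->
           in_ideal (fun s : 'I_r =>
             'X_s ^+ (if s.+1 == r then p ^ 2 else p)%N) q])
  /\ (forall s : nat, (s <= r)%N ->
        comul (dual_hopf HA) (z (p ^ s)%N)
          = \sum_(0 <= i < (p ^ s).+1) z (p ^ s - i)%N \ox z i)
  /\ (forall (L : fieldExtType K) (x : L)
        (alpha : {lrmorphism L -> tensor L {poly %/ ('X^(p ^ n) : {poly K})}}),
        <<1; x>>%VS = {:L}%VS ->
        \dim {:L} = (p ^ n)%N ->
        x ^+ (p ^ n) \in 1%VS ->
        alpha x = x \ox 1 + 1 \ox t
          + f *: \sum_(1 <= l < p) ((l`! * (p - l)`!)%N%:R)^-1
                   *: (x ^+ (p ^ r * l) \ox t ^+ (p ^ r * (p - l))) ->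
        forall (i : nat) (d : nat -> nat),
          (i < p ^ n)%N ->
          (forall l, (l <= r)%N -> (d l < p)%N) ->
          i = (\sum_(0 <= l < r.+1) d l * p ^ l)%N ->
          (forall s : nat, (s < r)%N ->
             act alpha (z (p ^ s)%N) (x ^+ i)
               = (d s)%:R *: x ^ (i%:Z - (p ^ s)%N%:Z))
          /\ act alpha (z (p ^ r)%N) (x ^+ i)
               = (d r)%:R *: x ^ (i%:Z - (p ^ r)%N%:Z)
                 - (i%:R * f) *: x ^ ((p ^ r * (p - 1))%N%:Z + i%:Z - 1)).
Proof.
have p_pr : prime p := pcharf_prime hp; have p_gt1 := prime_gt1 p_pr.
have nE : n = r.+1 by rewrite hr prednK // ltnW.
clear hr; subst n; subst t; have r_gt0 : (0 < r)%N by [].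
have ltN s : (s <= r)%N -> (p ^ s < p ^ r.+1)%N by move=> sr; rewrite ltn_exp2l.
split; [|split].
- have [pi pi_w] := mpoly_eval (w := fun s : 'I_r => z (p ^ s.+1)%N)
    (fun s h => dualC hp hcomul hcounit hz r_gt0 hf h (z (p ^ s.+1)%N)).
  have pi_surj h : exists q, pi q = h.
    elim/(dual_ind hp hcomul hcounit hz r_gt0 hf): h
      => [|_ _ [g <-] [h <-]|k _ _ [g <-] [h <-]|s /andP[s0 sr]].
    - by exists 1; rewrite rmorph1.
    - by exists (g * h); rewrite rmorphM.
    - by exists (k *: g + h); rewrite linearP.
    - have sr' : (s.-1 < r)%N by rewrite prednK.
      by exists 'X_(Ordinal sr'); rewrite pi_w /= prednK.
  exists pi; split=> //; apply: mpoly_truncated_kernel => // [s|].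
    rewrite pi_w; case: eqP => [->|sr]; first
      exact: (zqXpp_eq0 hp hcomul hcounit hz r_gt0).
    by apply: (zXp_eq0 hp hcomul hcounit hz); have := ltn_ord s; lia.
  (* The exponents are [p], taken r - 1 times, and p^2 once, with product p^(r + 1). *)
  rewrite (dim_dual hp); case: (r) r_gt0 => // k _.
  rewrite big_ord_recr /= eqxx (eq_bigr (fun=> p)) => [|i _].
    by rewrite prod_nat_const card_ord -expnD addn2.
  by rewrite eqSS ltn_eqF.
- by move=> s sr; apply: (dcomul_z hp hz); apply: ltN.
move=> L x alpha _ _ _ hx i d iN dp iE.
have digit s : (s <= r)%N -> 'C(i, p ^ s)%:R = (d s)%:R :> K.
  by move=> sr; rewrite iE natr_bin_digit.
(* For [i < p ^ s] the truncated exponent on the left differs from the negative one on the right,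
   but the binomial coefficient, hence the digit in [K], is 0. *)
have zx s : (s <= r)%N ->
    x ^+ (i - p ^ s) *+ 'C(i, p ^ s) = (d s)%:R *: x ^ (i%:Z - (p ^ s)%N%:Z).
  move=> sr; rewrite -scaler_nat digit //; case: (leqP (p ^ s) i) => [le_pi|lt_ip].
    by rewrite subzn.
  by rewrite -digit // bin_small // !scale0r.
have q_gt0 : (0 < p ^ r)%N by rewrite expn_gt0 prime_gt0.
split=> [s sr|]; rewrite (act_z hp hz hx) ?ltN ?(ltnW sr) //.
  rewrite (coef_comul_poly_exp_le f hp q_gt0); last by rewrite leq_exp2l // ltnW.
  by rewrite ltn_eqF ?ltn_exp2l // addr0 zx // ltnW.
rewrite (coef_comul_poly_exp_le f hp q_gt0) // eqxx zx // mulNrn; congr (_ - _).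
(* At [i = 0] the exponents [i.-1] and i - 1 disagree, but the factor [i] kills both terms. *)
rewrite -scaler_nat scalerA; case: i {iE iN digit zx} => [|i].
  by rewrite mul0r !scale0r.
congr (_ *: _); rewrite -subn1 exprnP; congr (x ^ _); lia.
Qed.
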